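(* For every generalised clause-set $F$, the lean kernel of $F$ equals the set $U(F)$ of clauses of $F$ which are used (as a leaf label) in some tree resolution refutation of $F$. Consequently $F$ is lean if and only if every clause of $F$ is used in some tree resolution refutation of $F$.
   Context: Each variable $v$ has a finite non-empty domain $D_v$; a literal is a pair $(v,\varepsilon)$, $\varepsilon\in D_v$, meaning ''$v\ne\varepsilon$''; a clause is a finite set of literals with no two distinct literals on the same variable; a clause-set is a finite set of clauses. A partial assignment $\varphi$ maps a finite set $\mathrm{var}(\varphi)$ of variables to values in their domains and satisfies $(v,\varepsilon)$ iff $v\in\mathrm{var}(\varphi)$ and $\varphi(v)\ne\varepsilon$; it is an autarky for $F$ iff every clause $C\in F$ with $\mathrm{var}(C)\cap\mathrm{var}(\varphi)\ne\emptyset$ is satisfied by $\varphi$, non-trivial iff $\mathrm{var}(\varphi)\cap\mathrm{var}(F)\neq\emptyset$. $F$ is lean iff it has no non-trivial autarky; the lean kernel of $F$ is the largest lean subset of $F$. Resolution: clauses $C_1,\dots,C_{|D_v|}$ are resolvable on variable $v$ if every value $\varepsilon\in D_v$ occurs in some literal $(v,\varepsilon)\in C_i$ and $R:=\bigcup_i\{x\in C_i:\mathrm{var}(x)\ne v\}$ is a clause (contains no two distinct literals on the same variable); $R$ is the resolvent. A tree resolution refutation of $F$ is a finite rooted tree whose leaves are labelled by clauses of $F$, each inner node labelled by a resolvent of the labels of its children, and the root labelled by the empty clause. *)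

(* Defs.v *)
From HB Require Import structures.
From mathcomp Require Import all_boot finmap boolp.

Set Implicit Arguments.
Unset Strict Implicit.
Unset Printing Implicit Defensive.

Local Open Scope fset_scope.

Section ClauseSets.

Variables (V : choiceType) (D : V -> finType).

(* The literal (v, e) is a negated atom: it stands for "v <> e". *)
Definition lit : choiceType := {v : V & D v}.

Definition clash_free (A : {fset lit}) : bool :=
  [forall x : A, forall y : A, (tag (val x) == tag (val y)) ==> (x == y)].

Record clause := Clause {lits : {fset lit}; _ : clash_free lits}.

HB.instance Definition _ := [isSub for lits].
HB.instance Definition _ := [Choice of clause by <:].

Definition var_clause (C : clause) : {fset V} := [fset tag x | x in lits C].

Definition clause_set := {fset clause}.

Definition var_cls (F : clause_set) : {fset V} :=
  \bigcup_(C <- F) var_clause C.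

Record passign := PAssign {
  pa_dom : {fset V};
  pa_val : forall v : pa_dom, D (val v)
}.

Definition sat_lit (phi : passign) (x : lit) : Prop :=
  exists h : tag x \in pa_dom phi, pa_val [` h] != tagged x.

Definition sat_clause (phi : passign) (C : clause) : Prop :=
  exists2 x, x \in lits C & sat_lit phi x.

Definition autarky (phi : passign) (F : clause_set) : Prop :=
  forall C, C \in F -> var_clause C `&` pa_dom phi != fset0 ->
    sat_clause phi C.

Definition nontrivial (phi : passign) (F : clause_set) : Prop :=
  pa_dom phi `&` var_cls F != fset0.

Definition lean (F : clause_set) : Prop :=
  ~ exists2 phi, autarky phi F & nontrivial phi F.

(* "Largest" is with respect to inclusion, so such a K is unique. *)
Definition is_lean_kernel (F K : clause_set) : Prop :=
  [/\ K `<=` F, lean K & forall K', K' `<=` F -> lean K' -> K' `<=` K].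

(* That the union of the side literals is again a clause is enforced by
   R having type clause. *)
Definition resolvent (v : V) (n : nat) (Cs : 'I_n -> clause) (R : clause) :
    Prop :=
  [/\ n = #|D v|,
      forall e : D v, exists i, (Tagged D e : lit) \in lits (Cs i)
    & lits R = \bigcup_(i <- enum 'I_n) [fset x in lits (Cs i) | tag x != v]].

Inductive tree :=
| Leaf of clause
| Inner (R : clause) (n : nat) of 'I_n -> tree.

Definition label (t : tree) : clause :=
  match t with Leaf C => C | @Inner R _ _ => R end.

Fixpoint resolution_tree (F : clause_set) (t : tree) : Prop :=
  match t with
  | Leaf C => C \in F
  | Inner R n ts =>
      (exists v, resolvent v (fun i => label (ts i)) R)
      /\ forall i, resolution_tree F (ts i)
  end.

Definition refutation (F : clause_set) (t : tree) : Prop :=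
  resolution_tree F t /\ lits (label t) = fset0.

Fixpoint leaf_label (C : clause) (t : tree) : Prop :=
  match t with
  | Leaf C' => C = C'
  | Inner _ n ts => exists i, leaf_label C (ts i)
  end.

Definition used (F : clause_set) (C : clause) : Prop :=
  exists2 t, refutation F t & leaf_label C t.

Definition used_clauses (F : clause_set) : clause_set :=
  [fset C in F | `[< used F C >]].

End ClauseSets.

(* Main.v *)
(** An autarky for [F] that touches one leaf of a resolution tree satisfies its
root label, so it touches no clause used in a refutation; hence [U(F)] is lean.

Conversely, let [W] be the set of variables of [U(F)] and [C] a clause of [F].
Every [w] in [W] is resolved away in some refutation of [F], and grafting a
derivation of [D] into this refutation, in place of a subtree whose label has
the same literal on the resolution variable, removes [w] from [D]
([eliminate]). Iterating, every [C] in [F \ U(F)] yields a derivation, using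
[C], of a subclause [E_C] of [C] without variables from [W]. The clauses
derivable with the help of [F \ U(F)] are closed under resolution and do not
include the empty clause, so by completeness of resolution the [E_C] have a
common satisfying assignment. Restricted to the variables outside [W], it is
an autarky for [F] satisfying [F \ U(F)]. *)

Require Import Defs.
From HB Require Import structures.
From mathcomp Require Import all_boot finmap boolp.

Set Implicit Arguments.
Unset Strict Implicit.
Unset Printing Implicit Defensive.

Local Open Scope fset_scope.

Section UsedClauses.

Variables (V : choiceType) (D : V -> finType).
Implicit Types (F : clause_set D) (C R E : clause D) (A : {fset lit D}).
Implicit Types (t : tree D) (x y : lit D) (v w : V) (phi : passign D).

(** * Clauses, resolvents and resolution trees *)

Lemma clash_freeP A :
  reflect {in A &, forall x y, tag x = tag y -> x = y} (clash_free A).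
Proof.
apply: (iffP forallP) => [h x y xA yA exy | h x].
  have /forallP /(_ [` yA]) /implyP := h [` xA].
  by rewrite /= exy eqxx => /(_ isT) /eqP [].
apply/forallP => y; apply/implyP => /eqP exy.
by apply/eqP/val_inj/h; rewrite ?fsvalP.
Qed.

Lemma clause_inj C x y :
  x \in lits C -> y \in lits C -> tag x = tag y -> x = y.
Proof. by move=> xC yC; apply: (clash_freeP _ (valP C)). Qed.

Lemma var_clauseP v C :
  reflect (exists2 x, x \in lits C & tag x = v) (v \in var_clause C).
Proof.
apply: (iffP idP) => [/imfsetP[x /= xC ->]|[x xC <-]]; first by exists x.
by apply/imfsetP; exists x.
Qed.

Lemma mem_var_clause x C : x \in lits C -> tag x \in var_clause C.
Proof. by move=> xC; apply/var_clauseP; exists x. Qed.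

Lemma var_clsP v F :
  reflect (exists2 C, C \in F & v \in var_clause C) (v \in var_cls F).
Proof.
apply: (iffP idP) => [/bigfcupP[C /andP[CF _] vC]|[C CF vC]]; first by exists C.
by apply/bigfcupP; exists C; rewrite ?CF.
Qed.

Lemma touchP C phi :
  reflect (exists2 v, v \in var_clause C & v \in pa_dom phi)
          (var_clause C `&` pa_dom phi != fset0).
Proof.
apply: (iffP (fset0Pn _)) => [[v]|[v vC vd]].
  by rewrite in_fsetI => /andP[vC vd]; exists v.
by exists v; rewrite in_fsetI vC.
Qed.

Lemma used_clausesP F C :
  reflect (C \in F /\ used F C) (C \in used_clauses F).
Proof.
rewrite /used_clauses !inE /=.
apply: (iffP andP) => [[CF /asboolP]|[CF /asboolP]] //.
Qed.

Lemma mem_resolvent v n (Cs : 'I_n -> clause D) R x : resolvent v Cs R ->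
  (x \in lits R) <-> (exists i, x \in lits (Cs i)) /\ tag x != v.
Proof.
case=> _ _ ->; split=> [/bigfcupP[i _]|[[i xi] xv]].
  by rewrite !inE => /andP[xi ->]; split => //; exists i.
by apply/bigfcupP; exists i; rewrite ?mem_enum // !inE xi.
Qed.

Lemma resolution_tree_leaf F t C :
  resolution_tree F t -> leaf_label C t -> C \in F.
Proof.
elim: t => [C' /= CF -> //|R n ts IH /= [_ hts] [i]].
by apply: IH.
Qed.

Lemma resolution_tree_sub F F' t :
  (forall C, leaf_label C t -> C \in F') ->
  resolution_tree F t -> resolution_tree F' t.
Proof.
elim: t => [C h _|R n ts IH h /= [res hts]] /=; first exact: h.
by split=> // i; apply: IH => // C lC; apply: h; exists i.
Qed.

Lemma used_sub F F' C : F' `<=` F -> used F' C -> used F C.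
Proof.
move=> /fsubsetP sub [t [rt lt] Ct]; exists t => //; split=> //.
apply: resolution_tree_sub (rt) => C' /(resolution_tree_leaf rt).
exact: sub.
Qed.

(** * Autarkies along resolution trees *)

Lemma var_label_leaf F t v : resolution_tree F t -> v \in var_clause (label t) ->
  exists2 C, leaf_label C t & v \in var_clause C.
Proof.
elim: t => [C _ vC|R n ts IH /= [[u res] hts]]; first by exists C.
move=> /var_clauseP[x /(mem_resolvent _ res)[[i xi] _] ev]; subst v.
have [C lC vC] := IH i (hts i) (mem_var_clause xi).
by exists C => //; exists i.
Qed.

(** A satisfied literal of a child's label survives in the resolvent unless it lies on the
    resolution variable [v]. If [phi] assigns [v], the child with the literal falsified by [phi] is
    taken instead. *)
Lemma autarky_sat_label F phi t C : autarky phi F ->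
  resolution_tree F t -> leaf_label C t ->
  var_clause C `&` pa_dom phi != fset0 -> sat_clause phi (label t).
Proof.
move=> aut; elim: t C => [C' C /= CF -> |R n ts IH C /= [[v res] hts] [i lC]].
  exact: aut.
move=> Cphi; have [x xi xsat] := IH i C (hts i) lC Cphi.
have [vd|vnd] := boolP (v \in pa_dom phi); last first.
  exists x => //; apply/(mem_resolvent _ res); split; first by exists i.
  by apply: contraNneq vnd => <-; case: xsat.
have [_ full _] := res.
have [j ej] := full (pa_val [` vd]).
(* Some leaf below [ts j] contains [v], so the label of [ts j] is satisfied; its only literal on [v]
   is falsified, so the satisfied one survives. *)
have [C' lC' vC'] := var_label_leaf (hts j) (mem_var_clause ej).
have [|y yj ysat] := IH j C' (hts j) lC'; first by apply/touchP; exists v.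
exists y => //; apply/(mem_resolvent _ res); split; first by exists j.
apply/eqP => yv; have ey := clause_inj yj ej yv.
case: ysat; rewrite ey /= => h /eqP; apply.
by rewrite (bool_irrelevance h vd).
Qed.

Lemma autarky_untouched_used F phi C v : autarky phi F -> used F C ->
  v \in var_clause C -> v \notin pa_dom phi.
Proof.
move=> aut [t [rt lt] Ct] vC; apply/negP => vd.
have [|x] := autarky_sat_label aut rt Ct; first by apply/touchP; exists v.
by rewrite lt.
Qed.

Lemma lean_used F : lean (used_clauses F).
Proof.
case=> phi aut /fset0Pn[v]; rewrite in_fsetI => /andP[vd /var_clsP[C CU vC]].
have /used_clausesP[_ [t [rt lt] Ct]] := CU.
suff CUU : used (used_clauses F) C.
  by rewrite (negPf (autarky_untouched_used aut CUU vC)) in vd.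
(* The same refutation serves: all its leaves are used in it. *)
exists t => //; split=> //; apply: resolution_tree_sub (rt) => C' lC'.
apply/used_clausesP; split; first exact: resolution_tree_leaf lC'.
by exists t.
Qed.

(** * Grafting and elimination of variables *)

Definition derives_with F C E : Prop :=
  exists t, [/\ resolution_tree F t, label t = E & leaf_label C t].

Lemma derives_with_resolvent F C v n (ts : 'I_n -> tree D) k E R :
  (forall i, resolution_tree F (ts i)) -> derives_with F C E ->
  resolvent v (fun i => if i == k then E else label (ts i)) R ->
  derives_with F C R.
Proof.
move=> hts [t [rt <- Ct]] res.
exists (Inner R (fun i => if i == k then t else ts i)); split => //=.
  split; last by move=> i; case: ifP.
  exists v; move: res; congr (resolvent v _ R).
  by apply: funext => i; case: ifP.
by exists k; rewrite eqxx.
Qed.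

(** If [E] has a literal on [v], its derivation replaces a child whose label has the same literal,
    so all values of [v] stay covered; otherwise [E] itself will do. *)
Lemma graft F C v n (ts : 'I_n -> tree D) R E :
  resolvent v (fun i => label (ts i)) R ->
  (forall i, resolution_tree F (ts i)) -> derives_with F C E ->
  clash_free (lits R `|` [fset x in lits E | tag x != v]) ->
  exists2 E', derives_with F C E' &
    lits E' `<=` lits R `|` [fset x in lits E | tag x != v].
Proof.
move=> res hts CE cf.
have [/var_clauseP[[u e] xE /= uv]|vE] := boolP (v \in var_clause E); last first.
  exists E => //; apply/fsubsetP => x xE; rewrite !inE xE.
  by rewrite (contraNneq _ vE) ?orbT // => <-; apply: mem_var_clause.
subst u; have [n_eq full _] := res; have [k ek] := full e.
pose Cs i := if i == k then E else label (ts i).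
pose A := \bigcup_(i <- enum 'I_n) [fset x in lits (Cs i) | tag x != v].
have sA : A `<=` lits R `|` [fset x in lits E | tag x != v].
  apply/fsubsetP => x /bigfcupP[i _]; rewrite !inE /Cs => /andP[].
  case: ifP => _ xi xv; first by rewrite xi xv orbT.
  by rewrite (proj2 (mem_resolvent x res)) //; split=> //; exists i.
have cfA : clash_free A.
  apply/clash_freeP => x y /(fsubsetP sA) xA /(fsubsetP sA) yA.
  exact: (clash_freeP _ cf).
exists (Clause cfA) => //.
apply: (@derives_with_resolvent F C v n ts k E _ hts CE).
split=> // e'; have [->|ne] := eqVneq e' e; first by exists k; rewrite eqxx.
(* The replaced child covered no value but [e], so the child covering [e'] is still in place. *)
have [j ej] := full e'; exists j; case: eqP => // jk; subst j.
have /eqP := clause_inj ej ek erefl.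
by rewrite eq_Tagged /= (negPf ne).
Qed.

Lemma clash_free_sub A B : A `<=` B -> clash_free B -> clash_free A.
Proof.
move=> /fsubsetP sub /clash_freeP cf; apply/clash_freeP => x y xA yA.
by apply: cf; apply: sub.
Qed.

(** The induction descends towards the leaf [C0] until [w] is the resolution variable. Each level
    grafts twice: before the descent, so that [E] cannot clash with the child's label on [v], and
    after it, to remove the literal on [v] that this label may have brought in. *)
Lemma eliminate F C w t C0 E :
  resolution_tree F t -> leaf_label C0 t -> w \in var_clause C0 ->
  w \notin var_clause (label t) -> derives_with F C E ->
  clash_free (lits (label t) `|` lits E) ->
  exists2 E', derives_with F C E' &
    lits E' `<=` lits (label t) `|` lits E /\ w \notin var_clause E'.
Proof.
move=> + + wC0; elim: t E => [C' E /= _ <-|R n ts IH E]; first by rewrite wC0.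
move=> /= [[v res] hts] [k lk] wR CE cf.
have [|E1 CE1 /fsubsetP sE1] := graft res hts CE.
  by apply: clash_free_sub cf; apply: fsetUS; apply: fset_sub.
have resk x : x \in lits (label (ts k)) -> tag x != v -> x \in lits R.
  by move=> xk xv; apply/(mem_resolvent _ res); split=> //; exists k.
have sE1' x : x \in lits E1 -> x \in lits R `|` lits E.
  by move=> /sE1; rewrite !inE => /orP[->|/andP[-> _]]; rewrite ?orbT.
have vE1 x : x \in lits E1 -> tag x != v.
  move=> /sE1; rewrite !inE => /orP[|/andP[]] //.
  by move=> /(mem_resolvent _ res)[].
have [wv|wv] := eqVneq w v.
  exists E1 => //; split; first by apply/fsubsetP.
  by apply/var_clauseP => -[x /vE1 /eqP xv xw]; apply: xv; rewrite xw.
have wk : w \notin var_clause (label (ts k)).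
  apply: contraNN wR => /var_clauseP[x xk xw]; apply/var_clauseP.
  by exists x => //; apply: resk; rewrite ?xw.
have [|E2 CE2 [/fsubsetP sE2 wE2]] := IH k E1 (hts k) lk wk CE1.
  (* No literal of [E1] is on [v], so literals from both sides with equal variables lie in the union
     of [lits R] and [lits E]. *)
  apply/clash_freeP => x y; rewrite !in_fsetU.
  case/orP=> xx /orP[] yy exy.
  - exact: (clause_inj xx yy exy).
  - have xv : tag x != v by rewrite exy vE1.
    apply: (clash_freeP _ cf) exy; last exact: sE1'.
    by rewrite in_fsetU resk.
  - have yv : tag y != v by rewrite -exy vE1.
    apply: (clash_freeP _ cf) exy; first exact: sE1'.
    by rewrite in_fsetU resk.
  - exact: (clause_inj xx yy exy).
have sub : lits R `|` [fset x in lits E2 | tag x != v] `<=` lits R `|` lits E.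
  apply/fsubsetP => x; rewrite in_fsetU => /orP[xR|]; first by rewrite in_fsetU xR.
  rewrite !inE => /andP[/sE2]; rewrite in_fsetU => /orP[xk xv|xE1 _].
    by rewrite resk.
  by have := sE1' _ xE1; rewrite in_fsetU.
have [|E3 CE3 sE3] := graft res hts CE2; first exact: clash_free_sub cf.
exists E3 => //; split; first exact: fsubset_trans sub.
apply/var_clauseP => -[x /(fsubsetP sE3)]; rewrite !inE.
case/orP=> [xR xw|/andP[xE2 _] xw].
  by move: wR; rewrite -xw mem_var_clause.
by move: wE2; rewrite -xw mem_var_clause.
Qed.

Lemma eliminate_used F C : C \in F ->
  exists2 E, derives_with F C E &
    lits E `<=` lits C /\ [disjoint var_clause E & var_cls (used_clauses F)].
Proof.
move=> CF; suff [E CE [sE dE]] : exists2 E, derives_with F C E &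
    lits E `<=` lits C /\
    {in enum_fset (var_cls (used_clauses F)), forall w, w \notin var_clause E}.
  exists E => //; split=> //; rewrite fdisjoint_sym; apply/fdisjointP => w wU.
  exact: dE.
have: {subset enum_fset (var_cls (used_clauses F)) <= var_cls (used_clauses F)}.
  by [].
elim: (enum_fset _) => [_|w s IH sub].
  by exists C => //; exists (Leaf C).
have [v vs|E CE [sE dE]] := IH; first by apply: sub; rewrite inE vs orbT.
have /var_clsP[C0 /used_clausesP[_ [t [rt lt] lC0]] wC0] := sub w (mem_head _ _).
have [||E' CE' [sE' wE']] := eliminate rt lC0 wC0 _ CE _.
- by apply/var_clauseP => -[x]; rewrite lt.
- by rewrite lt fset0U (valP E).
(* As the root label is empty, [E'] is a subclause of [E], and variables eliminated earlier do not
   return. *)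
rewrite lt fset0U in sE'; exists E' => //; split.
  exact: fsubset_trans sE.
move=> v; rewrite inE => /orP[/eqP -> //|/dE]; apply: contraNN.
by move=> /var_clauseP[x /(fsubsetP sE') xE <-]; apply: mem_var_clause.
Qed.

(** * Completeness of resolution *)

Lemma resolution_complete (P : clause D -> Prop) (s : seq V) :
  (forall v, 0 < #|D v|) ->
  (forall v n (Cs : 'I_n -> clause D) R,
     resolvent v Cs R -> (forall i, P (Cs i)) -> P R) ->
  (forall C, P C -> lits C <> fset0) ->
  exists f : forall v, D v, forall C, P C -> {subset var_clause C <= s} ->
    exists2 x, x \in lits C & x != Tagged D (f (tag x)).
Proof.
move=> D0 closed nonempty; elim: s => [|v s [f fP]].
  exists (fun v => enum_val (Ordinal (D0 v))) => C /nonempty /eqP /fset0Pn[x xC].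
  by move=> /(_ _ (mem_var_clause xC)).
(* If no value [e] at [v] extends [f], each [g e] falsifies some clause; these resolve on [v] to a
   clause over [s] falsified by [f], a contradiction. *)
pose g e := dfwith f (e : D v).
apply: contrapT => /forallNP none.
have {none} /choice[Cs CsP] (i : 'I_#|D v|) : exists C, [/\ P C,
    {subset var_clause C <= v :: s} &
    {in lits C, forall x, x = Tagged D (g (enum_val i) (tag x))}].
  have /existsNP[C /not_implyP[PC /not_implyP[sC nC]]] := none (g (enum_val i)).
  exists C; split=> // x xC; apply: contrapT => /eqP ne; apply: nC; by exists x.
pose A := \bigcup_(i <- enum 'I_#|D v|) [fset x in lits (Cs i) | tag x != v].
have gf e u : u != v -> g e u = f u by move=> uv; rewrite /g dfwith_out // eq_sym.
have Af x : x \in A -> x = Tagged D (f (tag x)).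
  move=> /bigfcupP[i _]; rewrite !inE => /andP[xi xv].
  by have [_ _ /(_ x xi)] := CsP i; rewrite gf.
have cfA : clash_free A.
  by apply/clash_freeP => x y /Af -> /Af -> /= ->.
have res : resolvent v Cs (Clause cfA).
  split=> // e; exists (enum_rank e).
  have := CsP (enum_rank e); rewrite enum_rankK.
  move: (Cs (enum_rank e)) => C [PC sC CE].
  (* Without a literal on [v], the clause would be over [s] and falsified by [f] already. *)
  have [/var_clauseP[x xC xv]|vC] := boolP (v \in var_clause C).
    by have := xC; rewrite (CE x xC) xv /g dfwith_in.
  have nv x : x \in lits C -> tag x != v.
    by move=> xC; apply: contraNneq vC => <-; apply: mem_var_clause.
  have [u uC|x xC /eqP[]] := fP _ PC.
    have /sC := uC; rewrite inE => /orP[/eqP uv|//].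
    by rewrite -uv uC in vC.
  by rewrite -(gf e) ?nv // -CE.
have PR : P (Clause cfA) by apply: closed res _ => i; case: (CsP i).
have [u /var_clauseP[x xA <-]|x xA /eqP[]] := fP _ PR.
  have /(mem_resolvent _ res)[[i xi] xv] := xA.
  have [_ /(_ _ (mem_var_clause xi)) + _] := CsP i.
  by rewrite inE (negPf xv).
exact: Af.
Qed.

Lemma lean_all_used F C : (forall v, 0 < #|D v|) ->
  lean F -> C \in F -> used F C.
Proof.
move=> D0 leanF CF; apply: contrapT => nC.
set W := var_cls (used_clauses F).
pose P E := exists2 C, ~ used F C & derives_with F C E.
have [||f fP] := @resolution_complete P (var_cls F) D0.
- move=> v n Cs R res PCs.
  have n0 : 0 < n by have [nv _ _] := res; rewrite nv.
  have /choice[ts tsP] i : exists t, resolution_tree F t /\ label t = Cs i.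
    by have [C' _ [t [rt lt _]]] := PCs i; exists t.
  have [C' nC' CE] := PCs (Ordinal n0); exists C' => //.
  apply: (@derives_with_resolvent F C' v n ts (Ordinal n0) _ _ _ CE).
    by move=> i; case: (tsP i).
  move: res; congr (resolvent v _ R).
  by apply: funext => i; case: eqP => [->//|_]; case: (tsP i).
- by move=> E [C' nC' [t [rt lt Ct]]] E0; apply: nC'; exists t; rewrite // /refutation lt.
have satF C' : C' \in F -> ~ used F C' -> exists x, [/\ x \in lits C',
    tag x \in var_cls F `\` W & x != Tagged D (f (tag x))].
  move=> C'F nC'; have [E CE [/fsubsetP sE dE]] := eliminate_used C'F.
  have vE x : x \in lits E -> tag x \in var_cls F.
    by move=> /sE /mem_var_clause xC; apply/var_clsP; exists C'.
  have [||x xE xf] := fP E; first by exists C'.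
    by move=> u /var_clauseP[x xE <-]; apply: vE.
  exists x; split; [exact: sE| |by []].
  by rewrite in_fsetD vE // andbT (fdisjointP dE) // mem_var_clause.
pose phi := @PAssign V D (var_cls F `\` W) (fun u => f (val u)).
apply: leanF; exists phi; last first.
  have [x [_ xX _]] := satF C CF nC; apply/fset0Pn; exists (tag x).
  by rewrite in_fsetI xX; move: xX; rewrite in_fsetD => /andP[].
move=> C' C'F /touchP[u uC']; rewrite /= in_fsetD => /andP[uW _].
have [|x [xC xX xf]] := satF C' C'F.
  move=> uC; move/negP: uW; apply; apply/var_clsP; exists C' => //.
  by apply/used_clausesP.
exists x => //; exists xX => /=; apply: contraNneq xf => ->.
by rewrite taggedK.
Qed.

End UsedClauses.

Theorem theorem1p5p1 (V : choiceType) (D : V -> finType)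
    (D_nonempty : forall v : V, (0 < #|D v|)%N) (F : clause_set D) :
  is_lean_kernel F (used_clauses F) /\
  (lean F <-> (forall C : clause D, C \in F -> used F C)).
Proof.
have sub : used_clauses F `<=` F by apply/fsubsetP => C /used_clausesP[].
split; [split=> //|split].
- exact: lean_used.
- move=> K KF leanK; apply/fsubsetP => C CK; apply/used_clausesP.
  split; first exact: (fsubsetP KF).
  (* Refutations of [K] are refutations of [F]. *)
  exact/(used_sub KF)/lean_all_used.
- by move=> leanF C; apply: lean_all_used.
- move=> all_used; suff <- : used_clauses F = F by apply: lean_used.
  apply/eqP; rewrite eqEfsubset sub; apply/fsubsetP => C CF.
  by apply/used_clausesP; split=> //; apply: all_used.
Qed.
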